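(* The set $conv(S^U)$ has exactly $2^{n-1}\sum_{i=1}^n u_i$ extreme points and exactly $n$ extreme rays.
   Context: Let $n\ge 1$, $r>0$ a real number and $u=(u_1,\dots,u_n)$ a vector of positive integers. Define $$S^U=\Big\{(x,y)\in\mathbb{Z}^n_+\times\mathbb{R}^n_+ : \sum_{i=1}^n x_iy_i\ge r,\ x\le u\Big\},$$ where $\mathbb{R}_+=[0,\infty)$, $\mathbb{Z}_+=\mathbb{Z}\cap[0,\infty)$ and $x\le u$ is componentwise. $conv$ denotes convex hull in $\mathbb{R}^n\times\mathbb{R}^n$. The extreme rays of $conv(S^U)$ are the extreme rays (up to positive scaling) of its recession cone. *)

(* Defs.v *)
From mathcomp Require Import all_boot all_order all_algebra.
From mathcomp Require Import all_classical all_reals all_analysis.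

Set Implicit Arguments.
Unset Strict Implicit.
Unset Printing Implicit Defensive.

Import Order.TTheory GRing.Theory Num.Theory.

Local Open Scope classical_set_scope.
Local Open Scope ring_scope.

Definition conv_hull {R : numDomainType} {V : lmodType R} (A : set V) : set V :=
  smallest (@convex_set R V) A.

Definition extreme_points {R : numDomainType} {V : lmodType R} (C : set V)
    : set V :=
  [set p | C p /\ forall (a b : V) (t : R), C a -> C b -> 0 < t < 1 ->
             p = t *: a + (1 - t) *: b -> a = p /\ b = p].

Definition recession_cone {R : numDomainType} {V : lmodType R} (C : set V)
    : set V :=
  [set d | forall (p : V) (t : R), C p -> 0 <= t -> C (p + t *: d)].

Definition half_line {R : numDomainType} {V : lmodType R} (d : V) : set V :=
  [set t *: d | t in [set t : R | 0 <= t]].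

(* Directions that differ by a positive factor span the same half-line, so
   the set of half-lines below counts extreme rays up to positive scaling.
   The last condition says that the half-line is a face of the convex cone K. *)
Definition extreme_rays_of_cone {R : numDomainType} {V : lmodType R}
    (K : set V) : set (set V) :=
  [set L | exists d : V, [/\ d <> 0, L = half_line d, L `<=` K &
     forall a b : V, K a -> K b -> L (a + b) -> L a /\ L b]].

Definition extreme_rays {R : numDomainType} {V : lmodType R} (C : set V)
    : set (set V) :=
  extreme_rays_of_cone (recession_cone C).

Definition SU {R : realType} {n : nat} (r : R) (u : 'I_n -> nat)
    : set ('rV[R]_n * 'rV[R]_n) :=
  [set p : 'rV[R]_n * 'rV[R]_n |
    [/\ forall i, p.1 ord0 i \is a Num.nat,
        forall i, 0 <= p.2 ord0 i,
        r <= \sum_(i < n) p.1 ord0 i * p.2 ord0 i &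
        forall i, p.1 ord0 i <= (u i)%:R]].

(* Main.v *)
Require Import Defs.
From mathcomp Require Import all_boot all_order all_algebra.
From mathcomp Require Import all_classical all_reals all_analysis.
From mathcomp Require Import ring lra.

Set Implicit Arguments.
Unset Strict Implicit.
Unset Printing Implicit Defensive.

Import Order.TTheory GRing.Theory Num.Theory.

Local Open Scope classical_set_scope.
Local Open Scope card_scope.
Local Open Scope ring_scope.

(** The points of S^U in which exactly one y_i is nonzero, with x_i = k >= 1
and y_i = r / k, while every other x_j sits at one of its bounds 0 or u_j, are
the extreme points.  There are u_i choices of k for each i and 2 ^ (n - 1)
choices of bounds, which gives the first count.

An extreme point of a convex hull lies in the generating set, so an extreme
point lies in S^U and cannot be the midpoint of two distinct points of
S^U.  Perturbing y excludes y_i > 0 with x_i = 0, two positive y_i, and slack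
in sum x_i y_i >= r; perturbing x_j by 1 excludes a value of x_j strictly
between its bounds when y_j = 0.  What is left is [extreme_is_vertex].

Conversely each such point is exposed ([is_vertex_extreme]): it is the only
minimizer over S^U of an affine function, whose main part
y_i + (r / k^2) x_i is constant on the tangent to the hyperbola x_i y_i = r at
x_i = k.  Strict convexity of the hyperbola makes k the only minimizing x_i,
a large weight on the other y_j keeps them at 0, and x_j or u_j - x_j keeps
x_j at its prescribed bound.  Neither this argument nor the one for the rays
writes a point of the hull as an explicit convex combination: it is enough to
exhibit convex sets that contain S^U.

For the rays, S^U is stable under increasing y, and on its hull the x_i are
bounded and the y_i are nonnegative; so the recession cone is
{0} x R_+^n ([recession_coneE]), and the extreme rays of an orthant are its n
coordinate half-lines ([extreme_raysE]). *)

(** * Convex hulls and their extreme points *)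

Lemma convex_setP (R : numDomainType) (V : lmodType R) (A : set V) :
  @convex_set R V A <->
  (forall (a b : V) (t : R), A a -> A b -> 0 < t < 1 ->
     A (t *: a + (1 - t) *: b)).
Proof.
split=> [cA a b t Aa Ab /andP[t0 t1]|cA].
  have := cA a b (Itv01 (ltW t0) (ltW t1)).
  by rewrite !inE; apply.
apply/convex_setW => a b; rewrite !inE => Aa Ab t t0 t1.
by rewrite inE; apply: cA => //; rewrite t0.
Qed.

Lemma convex_conv_hull (R : numDomainType) (V : lmodType R) (A : set V) :
  @convex_set R V (conv_hull A).
Proof.
apply/convex_setP => a b t hAa hAb t01 B BA; have [/convex_setP cB _] := BA.
exact: cB (hAa B BA) (hAb B BA) t01.
Qed.

Definition affine (R : numDomainType) (V : lmodType R) (g : V -> R) :=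
  forall (a b : V) (t : R),
    g (t *: a + (1 - t) *: b) = t * g a + (1 - t) * g b.

Lemma conv_hull_ge (R : numDomainType) (V : lmodType R) (A : set V)
    (g : V -> R) (c : R) : affine g ->
  (forall a, A a -> c <= g a) -> forall a, conv_hull A a -> c <= g a.
Proof.
move=> gaff Ac; apply: smallest_sub => //; apply/convex_setP => a b t /= ca cb.
move=> /andP[t0 t1]; rewrite gaff.
have -> : c = t * c + (1 - t) * c by rewrite mulrBl mul1r addrC subrK.
by rewrite lerD// ler_wpM2l// ltW// subr_gt0.
Qed.

Lemma conv_hull_translate (R : numDomainType) (V : lmodType R) (A : set V)
    (v : V) :
  (forall a, A a -> A (a + v)) -> forall a, conv_hull A a -> conv_hull A (a + v).
Proof.
move=> Av; apply: (@smallest_sub _ _ _ [set a | conv_hull A (a + v)]).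
  apply/convex_setP => a b t /= Aa Ab t01.
  have -> : t *: a + (1 - t) *: b + v = t *: (a + v) + (1 - t) *: (b + v).
    rewrite !scalerDr addrACA -scalerDl addrC [t + _]addrC subrK scale1r.
    by rewrite addrC.
  by have /convex_setP := @convex_conv_hull R V A; apply.
by move=> a Aa; apply: sub_gen_smallest; exact: Av.
Qed.

(** Removing an extreme point from a convex set leaves a convex set, so a point
outside A would be missing from a smaller convex set that contains A. *)
Lemma extreme_points_conv_hull_sub (R : numDomainType) (V : lmodType R)
    (A : set V) : extreme_points (conv_hull A) `<=` A.
Proof.
move=> p [Cp pext]; apply: contrapT => nAp.
suff: (conv_hull A `&` [set q | q <> p]) p by case.
apply: Cp; split=> [|a Aa]; last first.
  by split; [exact: sub_gen_smallest|move=> ap; apply: nAp; rewrite -ap].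
apply/convex_setP => a b t [Ca ap] [Cb bp] t01; split.
  by have /convex_setP := @convex_conv_hull R V A; apply.
by move=> eqp; apply: ap; have [] := pext a b t Ca Cb t01 (esym eqp).
Qed.

(** The points where g exceeds g p, together with p, form a convex set that
contains A, hence the hull; on that set a strict convex combination reaches
the value g p only if both of its ends are p. *)
Lemma exposed_extreme_point (R : realDomainType) (V : lmodType R) (A : set V)
    (g : V -> R) (p : V) : affine g -> A p ->
  (forall q, A q -> g p <= g q /\ (g q = g p -> q = p)) ->
  extreme_points (conv_hull A) p.
Proof.
move=> gaff Ap gp; split; first exact: sub_gen_smallest.
pose D := [set q | g p <= g q /\ (g q = g p -> q = p)].
have DE a b t : D a -> D b -> 0 < t < 1 ->
    g (t *: a + (1 - t) *: b) = g p -> a = p /\ b = p.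
  move=> [ga ap] [gb bp] /andP[t0 t1]; rewrite gaff => gE.
  by split; [apply: ap|apply: bp]; nra.
have cD : @convex_set R V D.
  apply/convex_setP => a b t Da Db t01; split; last first.
    move=> /DE-/(_ Da Db t01)[-> ->].
    by rewrite -scalerDl addrC subrK scale1r.
  rewrite gaff; case: Da => ga _; case: Db => gb _; case/andP: t01 => t0 t1.
  nra.
have CD : conv_hull A `<=` D by apply: smallest_sub => // q /gp.
move=> a b t /CD Da /CD Db t01 pE; apply: (DE _ _ t) => //.
by rewrite -pE.
Qed.

Lemma extreme_point_rigid (R : numFieldType) (V : lmodType R) (C : set V)
    (p d : V) : extreme_points C p -> C (p + d) -> C (p - d) -> d = 0.
Proof.
move=> [_ pext] Cpd Cpd'.
have half01 : 0 < (2^-1 : R) < 1 by rewrite invr_gt0 ltr0n invf_lt1 ?ltr1n ?ltr0n.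
have [|/(congr1 (fun v => v - p))+ _] := pext _ _ 2^-1 Cpd Cpd' half01.
  have -> : 1 - 2^-1 = 2^-1 :> R by field.
  rewrite -scalerDr addrACA subrr addr0 -mulr2n -[p *+ 2]scaler_nat scalerA.
  by rewrite mulVf ?scale1r// pnatr_eq0.
by rewrite addrC addKr subrr.
Qed.

(** * The vertices are extreme points *)

Definition is_vertex (R : realType) (n : nat) (r : R) (u : 'I_n -> nat)
    (i : 'I_n) (k : nat) (p : 'rV[R]_n * 'rV[R]_n) : Prop :=
  [/\ (0 < k <= u i)%N, p.1 ord0 i = k%:R, p.2 ord0 i = r / k%:R &
     forall j, j != i ->
       p.2 ord0 j = 0 /\ (p.1 ord0 j = 0 \/ p.1 ord0 j = (u j)%:R)].

Lemma is_vertex_SU (R : realType) (n : nat) (r : R) (u : 'I_n -> nat)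
    (i : 'I_n) (k : nat) (p : 'rV[R]_n * 'rV[R]_n) :
  0 < r -> is_vertex r u i k p -> SU r u p.
Proof.
move=> r0 [/andP[k0 ku] xi yi oth]; have kR : 0 < k%:R :> R by rewrite ltr0n.
split=> [j|j||j].
- have [->|/oth[_ [->|->]]] := eqVneq j i; by rewrite ?xi ?natr_nat ?rpred0.
- have [->|/oth[-> _]] := eqVneq j i; by rewrite // yi divr_ge0 ?ltW.
- rewrite (bigD1 i)//= xi yi big1 ?addr0; last first.
    by move=> j /oth[-> _]; rewrite mulr0.
  by rewrite mulrC divfK// gt_eqF.
- have [->|/oth[_ [->|->]]] := eqVneq j i; by rewrite ?xi ?ler_nat.
Qed.

(** The arithmetic behind the exposing function at a vertex with x_i = k: y is
y_i, Y stands for the sum of u_j y_j over j <> i, which bounds the contribution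
of these j to sum x_j y_j, and Z for the total distance of these x_j to
their prescribed bounds.  If x >= 1 then y >= r / x - Y, and
r / x + r x / k^2 >= 2 r / k with equality only at x = k.  The weight 3 on Y
settles the case x = 0, where Y >= r: weight 2 would allow equality at
k = 1. *)
Lemma tangent_hyperbola (R : realFieldType) (r y Y Z : R) (k x : nat) :
  0 < r -> (0 < k)%N -> 0 <= y -> 0 <= Y -> 0 <= Z -> r <= x%:R * y + Y ->
  let g := y + r / k%:R ^+ 2 * x%:R + 3 * Y + Z in
  2 * r / k%:R <= g /\
  (g = 2 * r / k%:R -> [/\ x = k, y = r / k%:R, Y = 0 & Z = 0]).
Proof.
move=> r0 k0 y0 Y0 Z0 rle g.
have kR : 1 <= k%:R :> R by rewrite ler1n.
have kR0 : 0 < k%:R :> R by rewrite ltr0n.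
have [x0|x0] := posnP x.
  rewrite x0 mul0r add0r in rle.
  have : 2 * r / k%:R < g.
    rewrite /g x0 mulr0 addr0; apply: (@le_lt_trans _ _ (2 * r)).
      by rewrite ler_pdivrMr// ler_peMr// mulr_ge0// ltW.
    lra.
  by move=> lt; split=> [|gE]; [exact: ltW|rewrite gE ltxx in lt].
have xR : 1 <= x%:R :> R by rewrite ler1n.
have xR0 : 0 < x%:R :> R by rewrite ltr0n.
(* The gap between the hyperbola and its tangent at k is a square. *)
have amgm : r / x%:R + r / k%:R ^+ 2 * x%:R - 2 * r / k%:R
    = r / (x%:R * k%:R ^+ 2) * (k%:R - x%:R) ^+ 2.
  by field; rewrite !gt_eqF.
have sq0 : 0 <= r / (x%:R * k%:R ^+ 2) * (k%:R - x%:R) ^+ 2.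
  by rewrite mulr_ge0 ?sqr_ge0// divr_ge0 ?mulr_ge0 ?exprn_ge0 ?ltW.
have ylb : r / x%:R - Y <= y.
  rewrite lerBlDr ler_pdivrMr// mulrDl mulrC; apply: le_trans rle _.
  by rewrite lerD2l ler_peMr.
split; first by rewrite /g; lra.
rewrite /g => gE.
have YE : Y = 0 by lra.
have ZE : Z = 0 by lra.
have /eqP : r / (x%:R * k%:R ^+ 2) * (k%:R - x%:R) ^+ 2 = 0 by lra.
rewrite mulf_eq0 gt_eqF/=; last by rewrite divr_gt0// mulr_gt0// exprn_gt0.
rewrite sqrf_eq0 subr_eq0 eqr_nat => /eqP kx; split=> //.
have : r / k%:R ^+ 2 * x%:R = r / k%:R by rewrite kx; field; rewrite gt_eqF.
lra.
Qed.

Lemma is_vertex_extreme (R : realType) (n : nat) (r : R) (u : 'I_n -> nat)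
    (i : 'I_n) (k : nat) (p : 'rV[R]_n * 'rV[R]_n) :
  0 < r -> (forall j, (0 < u j)%N) -> is_vertex r u i k p ->
  extreme_points (conv_hull (SU r u)) p.
Proof.
move=> r0 u0 vp; have pS := is_vertex_SU r0 vp.
case: vp => /andP[k0 ku] xi yi oth.
(* s j is minimal on [0, u_j] exactly at the bound taken by p. *)
pose s j (x : R) : R := if p.1 ord0 j == 0 then x else (u j)%:R - x.
pose Y (q : 'rV[R]_n * 'rV[R]_n) := \sum_(j | j != i) (u j)%:R * q.2 ord0 j.
pose Z (q : 'rV[R]_n * 'rV[R]_n) := \sum_(j | j != i) s j (q.1 ord0 j).
pose g (q : 'rV[R]_n * 'rV[R]_n) :=
  q.2 ord0 i + r / k%:R ^+ 2 * q.1 ord0 i + 3 * Y q + Z q.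
have Yaff : affine Y.
  move=> a b t; rewrite /Y !mulr_sumr -big_split/=; apply: eq_bigr => j _.
  by rewrite !mxE; ring.
have Zaff : affine Z.
  move=> a b t; rewrite /Z !mulr_sumr -big_split/=; apply: eq_bigr => j _.
  by rewrite /s; case: ifP => _; rewrite !mxE; ring.
have gaff : affine g by move=> a b t; rewrite /g Yaff Zaff/= !mxE; ring.
have gp : g p = 2 * r / k%:R.
  rewrite /g /Y /Z !big1 ?xi ?yi; first by field; rewrite pnatr_eq0 -lt0n.
    move=> j /oth[_ xj]; rewrite /s; case: eqP => // xj0.
    by case: xj => [/xj0|->] //; rewrite subrr.
  by move=> j /oth[-> _]; rewrite mulr0.
apply: (exposed_extreme_point gaff pS) => q [qnat qy0 qr qu].
have s0 j : 0 <= s j (q.1 ord0 j).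
  by rewrite /s; case: ifP => _; rewrite ?subr_ge0 ?natr_ge0.
have u_y0 j : 0 <= (u j)%:R * q.2 ord0 j by rewrite mulr_ge0.
have Y0 : 0 <= Y q by apply: sumr_ge0.
have Z0 : 0 <= Z q by apply: sumr_ge0.
have /natrP[x qx] := qnat i.
have rle : r <= x%:R * q.2 ord0 i + Y q.
  apply: (le_trans qr); rewrite (bigD1 i)//= qx lerD2l.
  by apply: ler_sum => j _; rewrite ler_wpM2r.
rewrite gp /g qx; have [ge gE] := tangent_hyperbola r0 k0 (qy0 i) Y0 Z0 rle.
split=> // /gE[xk yE YE ZE].
have yE0 j : j != i -> q.2 ord0 j = 0.
  move=> ji; have /psumr_eq0P : Y q = 0 by []; move=> /(_ _ j)/=.
  move=> /(_ (fun j _ => u_y0 j) ji)/eqP.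
  by rewrite mulf_eq0 pnatr_eq0 eqn0Ngt u0/= => /eqP.
have xE0 j : j != i -> q.1 ord0 j = p.1 ord0 j.
  move=> ji; have /psumr_eq0P : Z q = 0 by []; move=> /(_ _ j)/=.
  move=> /(_ (fun j _ => s0 j) ji); rewrite /s; case: eqP => [->//|nz].
  by move/eqP; rewrite subr_eq0 => /eqP <-; have [_ []] := oth _ ji.
rewrite [q]surjective_pairing [p]surjective_pairing; congr (_, _).
  by apply/rowP => j; have [->|/xE0//] := eqVneq j i; rewrite qx xk xi.
by apply/rowP => j; have [->|ji] := eqVneq j i; rewrite ?yE ?yi// yE0// (oth _ ji).1.
Qed.

(** * Every extreme point is a vertex *)

Lemma sum_mul_delta (R : pzRingType) (n : nat) (f : 'I_n -> R) (c : R)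
    (i : 'I_n) :
  \sum_j f j * (c *: delta_mx 0 i : 'rV[R]_n) ord0 j = f i * c.
Proof.
rewrite (bigD1 i)//= !mxE !eqxx mulr1 big1 ?addr0// => j ji.
by rewrite !mxE (negPf ji) !mulr0.
Qed.

(** The two bounds on w say that (x, y + w) and (x, y - w) both belong to S^U;
the midpoint of this segment is extreme, so the segment is degenerate. *)
Lemma extreme_y_rigid (R : realType) (n : nat) (r : R) (u : 'I_n -> nat)
    (p : 'rV[R]_n * 'rV[R]_n) (w : 'rV[R]_n) :
  extreme_points (conv_hull (SU r u)) p ->
  (forall j, `|w ord0 j| <= p.2 ord0 j) ->
  `|\sum_j p.1 ord0 j * w ord0 j| <= \sum_j p.1 ord0 j * p.2 ord0 j - r ->
  w = 0.
Proof.
move=> ext wy; rewrite ler_norml => /andP[lo hi].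
have [xnat y0 yr xu] := extreme_points_conv_hull_sub ext.
have [] // : ((0, w) : 'rV[R]_n * 'rV[R]_n) = 0.
apply: (extreme_point_rigid ext); apply: sub_gen_smallest; split=> [j|j||j] /=;
  rewrite ?addr0 ?subr0 ?mxE//.
- by have := wy j; rewrite ler_norml => /andP[]; lra.
- under eq_bigr do rewrite !mxE mulrDr.
  by rewrite big_split/=; lra.
- by have := wy j; rewrite ler_norml => /andP[]; lra.
- under eq_bigr do rewrite !mxE mulrDr mulrN.
  by rewrite big_split/= sumrN; lra.
Qed.

(** If x_i = 0 then y_i does not enter the sum and can move freely between 0
and 2 y_i. *)
Lemma extreme_y_pos (R : realType) (n : nat) (r : R) (u : 'I_n -> nat)
    (p : 'rV[R]_n * 'rV[R]_n) (i : 'I_n) :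
  extreme_points (conv_hull (SU r u)) p -> 0 < p.2 ord0 i -> 0 < p.1 ord0 i.
Proof.
move=> ext yi0; have [xnat y0 yr xu] := extreme_points_conv_hull_sub ext.
rewrite lt0r natr_ge0// andbT; apply/eqP => xi0.
have /(congr1 (fun v : 'rV[R]_n => v ord0 i)) :
    p.2 ord0 i *: delta_mx 0 i = 0 :> 'rV[R]_n.
  apply: (extreme_y_rigid ext) => [j|].
    rewrite !mxE/=; have [->|_] := eqVneq j i; last by rewrite mulr0 normr0.
    by rewrite mulr1 ger0_norm// ltW.
  by rewrite sum_mul_delta xi0 mul0r normr0 subr_ge0.
by rewrite !mxE !eqxx mulr1 => yi; rewrite yi ltxx in yi0.
Qed.

(** Two indices with y_i, y_j > 0 could trade weight: adding e / x_i to y_i and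
subtracting e / x_j from y_j keeps the sum unchanged. *)
Lemma extreme_y_uniq (R : realType) (n : nat) (r : R) (u : 'I_n -> nat)
    (p : 'rV[R]_n * 'rV[R]_n) (i j : 'I_n) :
  extreme_points (conv_hull (SU r u)) p ->
  0 < p.2 ord0 i -> 0 < p.2 ord0 j -> j = i.
Proof.
move=> ext yi0 yj0; apply/eqP; apply: contraT => ji.
have [xnat y0 yr xu] := extreme_points_conv_hull_sub ext.
have xi0 := extreme_y_pos ext yi0; have xj0 := extreme_y_pos ext yj0.
(* The largest transfer that keeps both coordinates nonnegative in either
   direction. *)
pose e := Order.min (p.1 ord0 i * p.2 ord0 i) (p.1 ord0 j * p.2 ord0 j).
have e0 : 0 < e by rewrite lt_min !mulr_gt0.
have ei : e / p.1 ord0 i <= p.2 ord0 i.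
  by rewrite ler_pdivrMr// [leRHS]mulrC ge_min lexx.
have ej : e / p.1 ord0 j <= p.2 ord0 j.
  by rewrite ler_pdivrMr// [leRHS]mulrC ge_min lexx orbT.
have /(congr1 (fun v : 'rV[R]_n => v ord0 i)) : (e / p.1 ord0 i) *: delta_mx 0 i
    + (- (e / p.1 ord0 j)) *: delta_mx 0 j = 0 :> 'rV[R]_n.
  apply: (extreme_y_rigid ext) => [l|].
    rewrite !mxE/=; have [->|li] := eqVneq l i.
      rewrite eq_sym (negPf ji) mulr1 mulr0 addr0 ger0_norm//.
      by rewrite divr_ge0// ltW.
    rewrite mulr0 add0r; have [->|lj] := eqVneq l j; last by rewrite mulr0 normr0.
    by rewrite mulr1 normrN ger0_norm// divr_ge0// ltW.
  under eq_bigr => l _ do rewrite mxE mulrDr.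
  rewrite big_split/= !sum_mul_delta mulrN.
  rewrite ![_ * (e / _)]mulrC !divfK ?gt_eqF//.
  by rewrite subrr normr0 subr_ge0.
rewrite !mxE !eqxx eq_sym (negPf ji) mulr1 mulr0 addr0 => /eqP.
by rewrite gt_eqF// divr_gt0.
Qed.

Lemma extreme_is_vertex (R : realType) (n : nat) (r : R) (u : 'I_n -> nat)
    (p : 'rV[R]_n * 'rV[R]_n) :
  0 < r -> extreme_points (conv_hull (SU r u)) p ->
  exists i k, is_vertex r u i k p.
Proof.
move=> r0 ext; have [xnat y0 yr xu] := extreme_points_conv_hull_sub ext.
have [i yi0] : exists i, 0 < p.2 ord0 i.
  apply: contrapT => /forallNP ynp.
  suff : \sum_j p.1 ord0 j * p.2 ord0 j = 0.
    by move=> s0; rewrite s0 leNgt r0 in yr.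
  apply: big1 => j _; have := ynp j; rewrite lt0r y0 andbT.
  by move/negP/negPn/eqP => ->; rewrite mulr0.
have xi0 := extreme_y_pos ext yi0.
have yj j : j != i -> p.2 ord0 j = 0.
  move=> ji; apply/eqP; apply: contraNT ji => yj0; apply/eqP.
  by apply: (extreme_y_uniq ext) => //; rewrite lt0r yj0 y0.
have sumE (x : 'rV[R]_n) :
    \sum_j x ord0 j * p.2 ord0 j = x ord0 i * p.2 ord0 i.
  by rewrite (bigD1 i)//= big1 ?addr0// => j /yj ->; rewrite mulr0.
have /natrP[k xk] := xnat i.
have k0 : (0 < k)%N by rewrite xk ltr0n in xi0.
exists i, k; split=> // [||j ji].
- by rewrite k0/= -(ler_nat R) -xk xu.
(* The constraint is tight: otherwise y_i could move by its slack e. *)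
- rewrite -xk; pose e := p.2 ord0 i - r / p.1 ord0 i.
  have e0 : 0 <= e by rewrite subr_ge0 ler_pdivrMr// mulrC -sumE.
  have /(congr1 (fun v : 'rV[R]_n => v ord0 i)) :
      e *: delta_mx 0 i = 0 :> 'rV[R]_n.
    apply: (extreme_y_rigid ext) => [l|].
      rewrite !mxE/=; have [->|li] := eqVneq l i; last by rewrite mulr0 normr0.
      by rewrite mulr1 ger0_norm// gerBl divr_ge0// ltW.
    rewrite sum_mul_delta sumE ger0_norm ?mulr_ge0 ?(ltW xi0)//.
    by rewrite mulrBr [_ * (r / _)]mulrC divfK// gt_eqF.
  by rewrite !mxE !eqxx mulr1 => /eqP; rewrite subr_eq0 => /eqP.
(* With y_j = 0 the sum ignores x_j, so x_j could move by 1 if it were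
   strictly between its bounds. *)
- split; first exact: yj.
  apply: contrapT => /not_orP[xj0 xju].
  have /natrP[m xm] := xnat j.
  have m0 : (0 < m)%N by rewrite lt0n -(eqr_nat R) -xm; apply/eqP.
  have mu : (m < u j)%N.
    rewrite ltn_neqAle -(ler_nat R) -xm xu andbT -(eqr_nat R) -xm.
    by apply/eqP.
  have : ((delta_mx 0 j, 0) : 'rV[R]_n * 'rV[R]_n) = 0.
    have nji : (j == i) = false by exact/negbTE.
    apply: (extreme_point_rigid ext); apply: sub_gen_smallest;
      split=> [l|l||l] /=; rewrite ?addr0 ?subr0 ?sumE ?mxE//=;
      rewrite 1?eq_sym ?nji ?addr0 ?subr0 -?sumE//.
    + by rewrite rpredD// natr_nat.
    + have [->|_] := eqVneq l j; last by rewrite addr0.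
      by rewrite xm natr1 ler_nat.
    + have [->|_] := eqVneq l j; last by rewrite subr0.
      by rewrite xm -(natrB R m0) natr_nat.
    + by apply: le_trans (xu l); rewrite gerBl.
  move=> /(congr1 (fun v : 'rV[R]_n * 'rV[R]_n => v.1 ord0 j)).
  by rewrite !mxE !eqxx => /eqP; rewrite oner_eq0.
Qed.

(** * Counting the vertices *)

(** The pair (i, k) : {i & 'I_(u i)} stands for the value x_i = k + 1, and the
Boolean function, on the indices other than i renumbered by [lift i], tells
which x_j are at their upper bound. *)
Definition vertex_index (n : nat) (u : 'I_n -> nat) : finType :=
  ({i : 'I_n & 'I_(u i)} * {ffun 'I_n.-1 -> bool})%type.

Lemma card_vertex_index (n : nat) (u : 'I_n -> nat) :
  #|vertex_index u| = (2 ^ (n - 1) * \sum_(i < n) u i)%N.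
Proof.
rewrite card_prod card_ffun card_bool card_ord mulnC subn1; congr (_ * _)%N.
rewrite card_tagged sumnE big_map big_enum/=.
by apply: eq_bigr => i _; rewrite card_ord.
Qed.

Definition vertex (R : realType) (n : nat) (r : R) (u : 'I_n -> nat)
    (v : vertex_index u) : 'rV[R]_n * 'rV[R]_n :=
  let: (ik, b) := v in let: existT i k := ik in
  (\row_j (if unlift i j is Some l then if b l then (u j)%:R else 0
           else k.+1%:R),
   \row_j (if j == i then r / k.+1%:R else 0)).

Lemma vertex_is_vertex (R : realType) (n : nat) (r : R) (u : 'I_n -> nat)
    (i : 'I_n) (k : 'I_(u i)) (b : {ffun 'I_n.-1 -> bool}) :
  is_vertex r u i k.+1 (vertex r (existT _ i k, b)).
Proof.
split=> [|||j ji]; rewrite ?mxE ?unlift_none ?eqxx//=.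
rewrite (negPf ji); split=> //; rewrite eq_sym in ji.
by have [l -> ->] := unlift_some ji; case: (b l); [right|left].
Qed.

Lemma vertex_inj (R : realType) (n : nat) (r : R) (u : 'I_n -> nat) :
  0 < r -> (forall i, (0 < u i)%N) -> injective (@vertex R n r u).
Proof.
move=> r0 u0 [[i k] b] [[i' k'] b'] /= [].
move=> /rowP xE /rowP yE.
have ii' : i = i'.
  have := yE i; rewrite !mxE eqxx; case: eqP => // _ /eqP.
  by rewrite gt_eqF// divr_gt0.
subst i'; congr (_, _).
  have := xE i; rewrite !mxE unlift_none => /eqP.
  by rewrite eqr_nat eqSS => /eqP kk'; congr existT; exact: val_inj.
apply/ffunP => l; have := xE (lift i l); rewrite !mxE liftK.
have un0 : ((u (lift i l))%:R == 0 :> R) = false by rewrite pnatr_eq0 gtn_eqF.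
by case: (b l) (b' l) => -[]// /eqP; rewrite ?un0// eq_sym un0.
Qed.

Lemma is_vertex_range (R : realType) (n : nat) (r : R) (u : 'I_n -> nat)
    (i : 'I_n) (k : nat) (p : 'rV[R]_n * 'rV[R]_n) :
  is_vertex r u i k p -> exists v : vertex_index u, vertex r v = p.
Proof.
move=> [/andP[k0 ku] xi yi oth].
have ku' : (k.-1 < u i)%N by rewrite prednK.
exists (existT _ i (Ordinal ku'),
  [ffun l => p.1 ord0 (lift i l) == (u (lift i l))%:R]).
rewrite [p]surjective_pairing /= prednK//; congr (_, _).
  apply/rowP => j; rewrite !mxE; case: unliftP => [l ->|->]; last by rewrite xi.
  rewrite ffunE; case: eqP => [->//|xu].
  by have [_ []] := oth (lift i l) (negbT (lift_eqF _ _)).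
apply/rowP => j; rewrite !mxE; have [->|ji] := eqVneq j i; first by rewrite yi.
by rewrite (oth j ji).1.
Qed.

Lemma card_range_injective (T : finType) (U : Type) (f : T -> U) :
  injective f -> range f #= `I_#|T|.
Proof.
move=> finj; have -> : range f = range (f \o @enum_val T T).
  apply/seteqP; split=> [_ [x _ <-]|_ [i _ <-]]; last by exists (enum_val i).
  by exists (enum_rank x); rewrite //= enum_rankK.
have einj : injective (f \o @enum_val T T).
  by apply: inj_comp finj _; exact: enum_val_inj.
by apply: card_eq_trans (inj_card_eq (in2W einj)) _; rewrite card_eq_sym card_II.
Qed.

Lemma extreme_pointsE (R : realType) (n : nat) (r : R) (u : 'I_n -> nat) :
  0 < r -> (forall i, (0 < u i)%N) ->
  extreme_points (conv_hull (SU r u)) = range (@vertex R n r u).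
Proof.
move=> r0 u0; apply/seteqP; split=> [p /(extreme_is_vertex r0)[i [k]]|p].
  by move=> /is_vertex_range[v <-]; exists v.
move=> [[[i k] b] _ <-]; apply: (is_vertex_extreme r0 u0).
exact: vertex_is_vertex.
Qed.

(** * The recession cone and its extreme rays *)

Definition y_unit (R : realType) (n : nat) (i : 'I_n) : 'rV[R]_n * 'rV[R]_n :=
  (0, delta_mx 0 i).

Lemma nonneg_slope (R : realFieldType) (a d : R) :
  (forall t, 0 <= t -> 0 <= a + t * d) -> 0 <= d.
Proof.
move=> ad; rewrite leNgt; apply/negP => d0.
have a0 : 0 <= a by have := ad 0 (lexx _); rewrite mul0r addr0.
have t0 : 0 <= (a + 1) / - d by rewrite divr_ge0 ?oppr_ge0 ?ltW// ltr_wpDl.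
have := ad _ t0; rewrite invrN mulrN mulNr divfK ?lt_eqF//; lra.
Qed.

(** Along a recession direction every affine function that is bounded below on
S^U has nonnegative slope; applied to x_i, - x_i (bounded below by - u_i) and
y_i this gives one inclusion, a vertex serving as base point.  The other
inclusion holds on S^U and passes to the hull because translations preserve
convexity. *)
Lemma recession_coneE (R : realType) (n : nat) (r : R) (u : 'I_n -> nat) :
  (0 < n)%N -> 0 < r -> (forall i, (0 < u i)%N) ->
  recession_cone (conv_hull (SU r u)) =
  [set d : 'rV[R]_n * 'rV[R]_n | d.1 = 0 /\ forall i, 0 <= d.2 ord0 i].
Proof.
move=> n0 r0 u0; apply/seteqP; split=> [d dC|[d1 d2] /= [-> d20] p t Cp t0].
  pose v : vertex_index u := (existT _ (Ordinal n0) (Ordinal (u0 _)), [ffun=> false]).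
  have Cp : conv_hull (SU r u) (vertex r v).
    by apply: sub_gen_smallest; exact/is_vertex_SU/vertex_is_vertex.
  move: (vertex r v) Cp => p Cp.
  have slope (g : 'rV[R]_n * 'rV[R]_n -> R) c (e : R) : affine g ->
      (forall q, SU r u q -> c <= g q) ->
      (forall t, g (p + t *: d) = g p + t * e) -> 0 <= e.
    move=> gaff gS ge; apply: (@nonneg_slope _ (g p - c)) => t t0.
    rewrite addrAC -ge subr_ge0; apply: (conv_hull_ge gaff gS).
    exact: dC.
  split.
    apply/rowP => i; rewrite mxE; apply/eqP; rewrite eq_le -oppr_ge0.
    apply/andP; split.
      apply: (slope (fun q => - q.1 ord0 i) (- (u i)%:R)) => [a b t|q|t].
      - by rewrite /= !mxE; ring.
      - by case=> _ _ _ /(_ i); rewrite lerN2.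
      - by rewrite /= !mxE; ring.
    apply: (slope (fun q => q.1 ord0 i) 0) => [a b t|q|t].
    - by rewrite /= !mxE.
    - by case=> /(_ i)/natr_ge0.
    - by rewrite /= !mxE.
  move=> i; apply: (slope (fun q => q.2 ord0 i) 0) => [a b t|q|t].
  - by rewrite /= !mxE.
  - by case.
  - by rewrite /= !mxE.
apply: conv_hull_translate Cp => -[x y] [xn y0 yr xu]; split=> [i|i||i] /=;
  rewrite ?scaler0 ?addr0//.
  by rewrite !mxE addr_ge0// mulr_ge0.
apply: (le_trans yr); apply: ler_sum => i _ /=.
by rewrite !mxE ler_wpM2l ?natr_ge0// lerDl mulr_ge0.
Qed.

Lemma half_lineZ (R : numFieldType) (V : lmodType R) (c : R) (d : V) :
  0 < c -> half_line (c *: d) = half_line d.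
Proof.
move=> c0; apply/seteqP; split=> [_ [t /= t0 <-]|_ [t /= t0 <-]].
  by exists (t * c); rewrite ?scalerA//= mulr_ge0// ltW.
exists (t / c); first by rewrite /= divr_ge0// ltW.
by rewrite scalerA divfK// gt_eqF.
Qed.

Lemma half_line_y_unit_inj (R : realType) (n : nat) :
  injective (fun i : 'I_n => half_line (y_unit R i)).
Proof.
move=> i j ij; have : half_line (y_unit R i) (y_unit R i).
  by exists 1; rewrite ?scale1r//= ler01.
rewrite ij => -[t _ /(congr1 (fun v : 'rV[R]_n * 'rV[R]_n => v.2 ord0 i))/eqP].
rewrite !mxE eqxx/=; have [//|_] := eqVneq i j.
by rewrite mulr0 eq_sym oner_eq0.
Qed.

(** If a direction d of an extreme ray has d_j > 0, split d into its j-th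
component and the rest, both in the orthant: the face property puts the j-th
component on the ray, so the ray is the j-th coordinate half-line.
Conversely, nonnegative vectors whose sum is supported at i are themselves
supported at i. *)
Lemma extreme_raysE (R : realType) (n : nat) (r : R) (u : 'I_n -> nat) :
  (0 < n)%N -> 0 < r -> (forall i, (0 < u i)%N) ->
  extreme_rays (conv_hull (SU r u)) =
  range (fun i : 'I_n => half_line (y_unit R i)).
Proof.
move=> n0 r0 u0; rewrite /extreme_rays recession_coneE//.
apply/seteqP; split=> [_ [d [d0 -> dK dface]]|_ [i _ <-]].
  have dL : half_line d d by exists 1; rewrite ?scale1r//= ler01.
  have [d10 d2] := dK d dL.
  have [j dj] : exists j, 0 < d.2 ord0 j.
    apply: contrapT => /forallNP dnp; apply: d0.
    rewrite [d]surjective_pairing d10; congr (_, _); apply/rowP => j.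
    by have := dnp j; rewrite mxE lt0r d2 andbT => /negP/negPn/eqP.
  have [|||[t /= t0 tE] _] := dface (d.2 ord0 j *: y_unit R j)
      (d - d.2 ord0 j *: y_unit R j).
  - split=> [|l]; first by rewrite /= scaler0.
    by rewrite !mxE mulr_ge0.
  - split=> [|l]; first by rewrite /= d10 scaler0 subr0.
    rewrite !mxE/=; have [->|_] := eqVneq l j; first by rewrite mulr1 subrr.
    by rewrite mulr0 subr0.
  - by rewrite addrC subrK.
  have t1 : 0 < t.
    rewrite lt0r t0 andbT; apply/eqP => t_0; move: tE; rewrite t_0 scale0r.
    move=> /(congr1 (fun v : 'rV[R]_n * 'rV[R]_n => v.2 ord0 j))/eqP.
    by rewrite !mxE !eqxx mulr1 lt_eqF.
  exists j => //; rewrite -(half_lineZ d t1) tE half_lineZ//.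
exists (y_unit R i); split=> //.
- move=> /(congr1 (fun v : 'rV[R]_n * 'rV[R]_n => v.2 ord0 i))/eqP.
  by rewrite !mxE !eqxx oner_eq0.
- move=> _ [t /= t0 <-]; split; first by rewrite /= scaler0.
  by move=> j; rewrite !mxE mulr_ge0// ler0n.
- have side (a b : 'rV[R]_n * 'rV[R]_n) : a.1 = 0 -> (forall j, 0 <= a.2 ord0 j) ->
      (forall j, 0 <= b.2 ord0 j) -> half_line (y_unit R i) (a + b) ->
      half_line (y_unit R i) a.
    move=> a1 a2 b2 [t t0 tE]; exists (a.2 ord0 i); first exact: a2.
    rewrite [RHS]surjective_pairing a1; congr (_, _); first by rewrite /= scaler0.
    apply/rowP => j; rewrite !mxE eqxx/=.
    have [->|ji] := eqVneq j i; first by rewrite mulr1.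
    move: tE => /(congr1 (fun v : 'rV[R]_n * 'rV[R]_n => v.2 ord0 j)).
    rewrite !mxE (negPf ji) andbF !mulr0 => ab0.
    by have := a2 j; have := b2 j; lra.
  move=> a b [a1 a2] [b1 b2] abL; split; first exact: side abL.
  by rewrite addrC in abL; exact: side abL.
Qed.

Theorem corollary1 (R : realType) (n : nat) (n_ge1 : (1 <= n)%N)
    (r : R) (r_gt0 : 0 < r) (u : 'I_n -> nat)
    (u_gt0 : forall i : 'I_n, (0 < u i)%N) :
  (extreme_points (conv_hull (SU r u))
     #= `I_(2 ^ (n - 1) * \sum_(i < n) u i)%N) /\
  (extreme_rays (conv_hull (SU r u)) #= `I_n).
Proof.
rewrite extreme_pointsE// extreme_raysE// -card_vertex_index; split.
  exact/card_range_injective/vertex_inj.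
rewrite -[n in `I_n]card_ord.
exact/card_range_injective/half_line_y_unit_inj.
Qed.
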